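(* Let $d \geq 3$ be odd. Suppose that there exist primes $p,q$ dividing $d$ such that $q \equiv 1 \pmod p$. Then there exist a number field $k$ and a diagonal surface of degree $d$ over $k$ which fails the Hasse principle for lines.
   Context: A diagonal surface of degree $d$ over a field $k$ is the surface $S \subset \mathbb{P}^3_k$ given by $a_0x_0^d + a_1x_1^d + a_2x_2^d + a_3x_3^d = 0$ with $a_0,a_1,a_2,a_3 \in k^*$. For a field extension $K/k$, a line on $S$ over $K$ is a line in $\mathbb{P}^3$ defined over $K$ and contained in $S$. A surface $S$ over a number field $k$ fails the Hasse principle for lines if $S$ contains a line over the completion $k_v$ for every place $v$ of $k$ but contains no line over $k$. *)

(* Defs.v *)
From HB Require Import structures.
From mathcomp Require Import all_boot all_order all_algebra all_field.
From mathcomp Require Import reals.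

Set Implicit Arguments.
Unset Strict Implicit.
Unset Printing Implicit Defensive.

Import Order.TTheory GRing.Theory Num.Theory.
Local Open Scope ring_scope.

Record absolute_value (R : realType) (k : fieldType) := AbsoluteValue {
  absv :> k -> R;
  absv_ge0 : forall x, 0 <= absv x;
  absv_eq0 : forall x, absv x = 0 <-> x = 0;
  absvM : forall x y, absv (x * y) = absv x * absv y;
  absvD : forall x y, absv (x + y) <= absv x + absv y
}.

(* The places of k are the equivalence classes of nontrivial absolute values;
   equivalent absolute values have the same completion as a field. *)
Definition nontrivial_absv (R : realType) (k : fieldType)
    (v : absolute_value R k) : Prop :=
  exists2 x : k, x != 0 & v x != 1.

Definition absv_cauchy (R : realType) (K : fieldType)
    (w : absolute_value R K) (u : nat -> K) : Prop :=
  forall e : R, 0 < e ->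
    exists N : nat, forall m n : nat,
      (N <= m)%N -> (N <= n)%N -> w (u m - u n) < e.

Definition absv_converges (R : realType) (K : fieldType)
    (w : absolute_value R K) (u : nat -> K) (l : K) : Prop :=
  forall e : R, 0 < e ->
    exists N : nat, forall n : nat, (N <= n)%N -> w (u n - l) < e.

(* (K, w), with the embedding i, is a completion of (k, v); it is unique up to
   a unique isometric k-isomorphism. *)
Record is_completion (R : realType) (k : fieldType) (v : absolute_value R k)
    (K : fieldType) (i : {rmorphism k -> K}) (w : absolute_value R K) : Prop :=
  IsCompletion {
    completion_extends : forall x : k, w (i x) = v x;
    completion_dense : forall (y : K) (e : R), 0 < e ->
      exists x : k, w (y - i x) < e;
    completion_complete : forall u : nat -> K, absv_cauchy w u ->
      exists l : K, absv_converges w u l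
  }.

Record diagonal_surface (k : fieldType) := DiagonalSurface {
  degree : nat;
  dcoef : 'I_4 -> k;
  dcoef_neq0 : forall j, dcoef j != 0
}.

(* x is a vector of homogeneous coordinates. *)
Definition on_surface (k : fieldType) (S : diagonal_surface k)
    (K : fieldType) (i : {rmorphism k -> K}) (x : 'rV[K]_4) : Prop :=
  \sum_(j < 4) i (dcoef S j) * x ord0 j ^+ degree S = 0.

(* A line of P^3 over K is (the row space of) a rank 2 matrix over K. It is
   contained in S as a variety, hence the points over all extensions of K:
   K-points alone would not suffice over a finite field. *)
Definition contains_line_over (k : fieldType) (S : diagonal_surface k)
    (K : fieldType) (i : {rmorphism k -> K}) : Prop :=
  exists2 L : 'M[K]_(2, 4), \rank L = 2%N &
    forall (E : fieldType) (f : {rmorphism K -> E}) (x : 'rV[E]_4),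
      x != 0 -> (x <= map_mx f L)%MS -> on_surface S (f \o i) x.

Definition fails_Hasse_principle_for_lines (R : realType)
    (k : fieldExtType rat) (S : diagonal_surface k) : Prop :=
  (forall v : absolute_value R k, nontrivial_absv v ->
     forall (K : fieldType) (i : {rmorphism k -> K}) (w : absolute_value R K),
       is_completion v i w -> contains_line_over S i)
  /\ ~ contains_line_over S (@idfun k).

(* Main.v *)
(* Over a field of characteristic 0 the surface x0^d + a x1^d + b x2^d + ab x3^d
   contains a line if and only if a or b is a d-th power (d odd, d >= 3).

   Let p^al be the exact power of p dividing d and L = Q(zeta) with zeta of order
   p^al q.  As p divides q - 1, there is an automorphism s of L of order p fixing the
   p-power roots of unity; let k be its fixed field.  By Hilbert 90, L = k(y) with
   y^p = r in k, and L = k(zeta_q).  Let u be the value at q^q of the q-th cyclotomic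
   polynomial, and take a = r^(d/p), b = u^(d/q).

   If a completion K of k contains zeta_q, then r is a p-th power in K.  Otherwise u is
   a q-th power in K: at the places above q because u = 1 mod q^3; at the other
   finite places because primes dividing u are 1 mod q, while modulo a prime l not
   congruent to 1 mod q everything is a q-th power; at the archimedean places because
   u > 0.  Globally, a is not a d-th power because s(y)/y is a primitive p-th root of
   unity, and b is not because taking norms to Q would make u a q-th power of an
   integer, whereas it lies strictly between two consecutive q-th powers. *)
Require Import Defs.
From HB Require Import structures.
From mathcomp Require Import all_boot all_order all_algebra all_field.
From mathcomp Require Import reals.
From mathcomp Require Import all_fingroup all_solvable all_character.
From mathcomp Require Import boolp zify ring lra.

Set Implicit Arguments.
Unset Strict Implicit.
Unset Printing Implicit Defensive.

Import Order.TTheory GRing.Theory Num.Theory.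
Local Open Scope ring_scope.

(** * Absolute values *)

Lemma natr_gt_exists (R : realType) (x : R) : exists n : nat, x < n%:R.
Proof.
exists (Num.bound `|x|); apply: le_lt_trans (ler_norm x) _.
by rewrite archi_boundP // normr_ge0.
Qed.

Lemma bernoulli (R : realType) (h : R) n : 0 <= h -> 1 + n%:R * h <= (1 + h) ^+ n.
Proof.
move=> h0; elim: n => [|n IHn]; first by rewrite mul0r addr0 expr0.
rewrite exprS -natr1.
have n0 : 0 <= n%:R :> R by rewrite ler0n.
have : 0 <= n%:R * h by rewrite mulr_ge0.
nra.
Qed.

(** If z = 1 + h with h > 0, squaring Bernoulli's inequality gives z^(2T) > (T h)^2, which outruns
    every affine function of T. This turns weak bounds on all powers of an absolute value into the
    bound 1. *)
Lemma affine_powers_le1 (R : realType) (z A B : R) : 0 <= z ->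
  (forall t : nat, z ^+ t <= A * t%:R + B) -> z <= 1.
Proof.
move=> z0 zle; rewrite leNgt; apply/negP => z1.
have h0 : 0 < z - 1 by rewrite subr_gt0.
have [t] := natr_gt_exists ((2 * `|A| + `|B|) / (z - 1) ^+ 2).
rewrite ltr_pdivrMr ?exprn_gt0 // => t_gt.
have := zle (t.+1 * 2)%N; apply/negP; rewrite -ltNge exprM.
have := bernoulli t.+1 (ltW h0); rewrite [1 + (_ - 1)]addrC subrK natrM.
have: (t%:R : R) < t.+1%:R by rewrite ltr_nat.
have: (1 : R) <= t.+1%:R by rewrite ler1n.
move: (z ^+ t.+1) (t.+1%:R) t_gt => Z T t_gt T1 tT ZT.
have AA := ler_norm A; have BB := ler_norm B.
have A0 := normr_ge0 A; have B0 := normr_ge0 B.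
set h := z - 1 in h0 t_gt ZT *.
have Th : 0 < T * h by rewrite mulr_gt0 //; lra.
have Z2 : (T * h) ^+ 2 < Z ^+ 2 by rewrite ltr_pXn2r ?nnegrE //; lra.
apply: lt_trans Z2; rewrite exprMn.
have TT : 2 * `|A| + `|B| < T * h ^+ 2.
  by apply: lt_trans t_gt _; rewrite ltr_pM2r ?exprn_gt0.
have : T * (2 * `|A| + `|B|) < T * (T * h ^+ 2) by rewrite ltr_pM2l //; lra.
nra.
Qed.

Lemma geometric_small (R : realType) (C rho e : R) : 0 <= rho -> rho < 1 -> 0 < e ->
  exists N : nat, forall n, (N <= n)%N -> C * rho ^+ n < e.
Proof.
move=> r0 r1 e0.
have [r_eq0|r_neq0] := eqVneq rho 0.
  by exists 1%N => -[|n] // _; rewrite r_eq0 expr0n mulr0.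
have rp : 0 < rho by rewrite lt_def r_neq0.
have h0 : 0 < rho^-1 - 1 by rewrite subr_gt0 invf_gt1.
have [N NP] := natr_gt_exists (`|C| / e / (rho^-1 - 1)).
exists N => n Nn; apply: le_lt_trans (_ : `|C| * rho ^+ n < e).
  by rewrite ler_wpM2r ?exprn_ge0 ?ler_norm.
rewrite -ltr_pdivlMr ?exprn_gt0 // -exprVn mulrC -ltr_pdivrMr //.
have := bernoulli n (ltW h0); rewrite [1 + (_ - 1)]addrC subrK.
apply: lt_le_trans.
move: NP; rewrite ltr_pdivrMr // => /lt_le_trans lt.
apply: (@lt_trans _ _ (n%:R * (rho^-1 - 1))); last by rewrite ltrDr.
by apply: lt; rewrite ler_pM2r // ler_nat.
Qed.

(** * Absolute values: first properties and the ultrametric inequality *)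

Lemma absv1 (R : realType) (K : fieldType) (w : absolute_value R K) : w 1 = 1.
Proof.
have w1 : w 1 != 0 by apply/eqP => /absv_eq0/eqP; rewrite oner_eq0.
by apply: (mulfI w1); rewrite -absvM !mulr1.
Qed.

Lemma absv0 (R : realType) (K : fieldType) (w : absolute_value R K) : w 0 = 0.
Proof. exact/absv_eq0. Qed.

Lemma absvX (R : realType) (K : fieldType) (w : absolute_value R K) x n :
  w (x ^+ n) = w x ^+ n.
Proof. by elim: n => [|n IHn]; rewrite ?expr0 ?absv1 // !exprS absvM IHn. Qed.

Lemma absvN (R : realType) (K : fieldType) (w : absolute_value R K) x :
  w (- x) = w x.
Proof.
rewrite -mulN1r absvM; suff -> : w (-1) = 1 by rewrite mul1r.
by apply/eqP; rewrite -(@pexpr_eq1 _ _ 2) ?absv_ge0 // -absvX sqrrN expr1n absv1.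
Qed.

Lemma absvB (R : realType) (K : fieldType) (w : absolute_value R K) x y :
  w (x - y) = w (y - x).
Proof. by rewrite -absvN opprB. Qed.

Lemma absv_gt0 (R : realType) (K : fieldType) (w : absolute_value R K) x :
  x != 0 -> 0 < w x.
Proof.
by move=> x0; rewrite lt_def absv_ge0 andbT; apply: contra_neq x0 => /absv_eq0.
Qed.

Lemma absvV (R : realType) (K : fieldType) (w : absolute_value R K) x :
  w x^-1 = (w x)^-1.
Proof.
have [->|x0] := eqVneq x 0; first by rewrite invr0 absv0 invr0.
have wx := absv_gt0 w x0.
by apply: (mulfI (lt0r_neq0 wx)); rewrite -absvM !mulfV ?absv1 ?lt0r_neq0.
Qed.

Lemma absv_sum (R : realType) (K : fieldType) (w : absolute_value R K)
  (I : Type) (r : seq I) (P : pred I) (F : I -> K) :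
  w (\sum_(i <- r | P i) F i) <= \sum_(i <- r | P i) w (F i).
Proof.
apply: (big_ind2 (fun x y => w x <= y)) => //; first by rewrite absv0.
by move=> x1 x2 y1 y2 h1 h2; apply: le_trans (absvD _ _ _) (lerD h1 h2).
Qed.

Lemma absv_subX (R : realType) (K : fieldType) (w : absolute_value R K) (B : R) x y n :
  w x <= B -> w y <= B -> w (x ^+ n - y ^+ n) <= w (x - y) * (n%:R * B ^+ n.-1).
Proof.
move=> xB yB; rewrite subrXX absvM ler_wpM2l ?absv_ge0 //.
apply: le_trans (absv_sum _ _ _ _) _.
have -> : n%:R * B ^+ n.-1 = \sum_(i < n) B ^+ n.-1 by rewrite sumr_const card_ord mulr_natl.
apply: ler_sum => i _; rewrite absvM !absvX.
have B0 : 0 <= B by apply: le_trans xB; apply: absv_ge0.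
have -> : B ^+ n.-1 = B ^+ (n.-1 - i) * B ^+ i.
  by rewrite -exprD subnK //; have := ltn_ord i; lia.
by apply: ler_pM; rewrite ?exprn_ge0 ?absv_ge0 // lerXn2r ?nnegrE ?absv_ge0.
Qed.

(** When |2| <= 1, binary expansion bounds |m| by the number of digits of m. For m = n^t that number
    is affine in t, so |n|^t cannot grow exponentially. *)
Lemma absv_natr_le1 (R : realType) (K : fieldType) (w : absolute_value R K) :
  w 2%:R <= 1 -> forall n, w n%:R <= 1.
Proof.
move=> w2 n.
have bits B m : (m < 2 ^ B)%N -> w m%:R <= B%:R.
  elim: B m => [|B IHB] m; first by rewrite expn0 ltnS leqn0 => /eqP->; rewrite absv0.
  rewrite expnS => mB; have mE : (m = 2 * m./2 + odd m)%N by lia.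
  rewrite mE natrD natrM; apply: le_trans (absvD _ _ _) _; rewrite absvM -[B.+1%:R]natr1.
  apply: lerD; last by case: odd; rewrite ?absv1 ?absv0.
  apply: le_trans (_ : w m./2%:R <= _); last by apply: IHB; lia.
  by rewrite ler_piMl ?absv_ge0.
apply: (@affine_powers_le1 _ _ n%:R 1); first exact: absv_ge0.
move=> t; rewrite -absvX -natrX -natrM natr1; apply: bits.
rewrite expnS expnM; apply: leq_ltn_trans (_ : (2 ^ n) ^ t < _)%N.
  by case: t => // t; rewrite leq_exp2r // ltnW // ltn_expl.
by rewrite ltn_Pmull // !expn_gt0.
Qed.

(** The binomial expansion of (x + y)^t has t + 1 terms, each of value at most M^t because integers
    have value at most 1. Hence (|x + y| / M)^t <= t + 1 for all t. *)
Lemma absv_ultrametric (R : realType) (K : fieldType) (w : absolute_value R K) :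
  (forall n, w n%:R <= 1) -> forall x y M, w x <= M -> w y <= M -> w (x + y) <= M.
Proof.
move=> wn x y M xM yM.
have M0 : 0 <= M by apply: le_trans xM; apply: absv_ge0.
have [M_eq0|M_neq0] := eqVneq M 0.
  by apply: le_trans (absvD _ _ _) _; rewrite M_eq0 in xM yM *; lra.
have Mp : 0 < M by rewrite lt_def M_neq0.
rewrite -[leRHS]mul1r -ler_pdivrMr //.
apply: (@affine_powers_le1 _ _ 1 1); first by rewrite divr_ge0 ?absv_ge0.
move=> t; rewrite mul1r expr_div_n ler_pdivrMr ?exprn_gt0 // natr1 -absvX exprDn.
apply: le_trans (absv_sum _ _ _ _) _.
rewrite -[X in X%:R * _]card_ord mulr_natl -sumr_const; apply: ler_sum => i _.
rewrite -mulr_natl absvM; apply: le_trans (_ : w (x ^+ (t - i) * y ^+ i) <= _).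
  by rewrite ler_piMl ?absv_ge0.
have -> : M ^+ t = M ^+ (t - i) * M ^+ i by rewrite -exprD subnK // -ltnS.
by rewrite absvM !absvX; apply: ler_pM; rewrite ?exprn_ge0 ?absv_ge0 // lerXn2r ?nnegrE ?absv_ge0.
Qed.

(** * Limits and Newton iteration in complete fields *)

Lemma absv_complete_geometric (R : realType) (K : fieldType) (w : absolute_value R K)
    (u : nat -> K) (C rho : R) :
  (forall u : nat -> K, absv_cauchy w u -> exists l : K, absv_converges w u l) ->
  0 <= rho -> rho < 1 -> (forall n, w (u n.+1 - u n) <= C * rho ^+ n) ->
  exists l, absv_converges w u l.
Proof.
move=> cK r0 r1 step; apply: cK => e e0.
have C0 : 0 <= C by have := step 0; rewrite expr0 mulr1; apply: le_trans; apply: absv_ge0.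
have r1p : 0 < 1 - rho by rewrite subr_gt0.
have tail n k : w (u (n + k)%N - u n) <= C * rho ^+ n / (1 - rho) * (1 - rho ^+ k).
  elim: k => [|k IHk]; first by rewrite addn0 subrr absv0 expr0 subrr mulr0.
  have -> : u (n + k.+1)%N - u n = (u (n + k).+1 - u (n + k)%N) + (u (n + k)%N - u n).
    by rewrite addnS addrA subrK.
  apply: le_trans (absvD _ _ _) _; apply: le_trans (lerD (step _) IHk) _.
  rewrite exprD exprS; rewrite le_eqVlt; apply/orP; left; apply/eqP; field; lra.
have e2 : 0 < e * (1 - rho) / 2 by rewrite divr_gt0 ?mulr_gt0.
have [N NP] := geometric_small C r0 r1 e2.
have near m : (N <= m)%N -> w (u m - u N) < e / 2.
  move=> Nm; rewrite -(subnKC Nm); apply: le_lt_trans (tail _ _) _.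
  apply: le_lt_trans (_ : C * rho ^+ N / (1 - rho) < _).
    rewrite ler_piMr //; first by rewrite divr_ge0 ?mulr_ge0 ?exprn_ge0 // ltW.
    by rewrite lerBlDr lerDl exprn_ge0.
  by rewrite ltr_pdivrMr //; have := NP N (leqnn _); lra.
exists N => m n Nm Nn.
have -> : u m - u n = (u m - u N) + (u N - u n) by rewrite addrA subrK.
apply: le_lt_trans (absvD _ _ _) _; rewrite [w (u N - _)]absvB.
by have := near _ Nm; have := near _ Nn; lra.
Qed.

Lemma absv_limit_power (R : realType) (K : fieldType) (w : absolute_value R K)
    (u : nat -> K) (l c : K) m :
  absv_converges w u l ->
  (forall e : R, 0 < e -> exists N, forall n, (N <= n)%N -> w (u n ^+ m - c) < e) ->
  l ^+ m = c.
Proof.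
move=> ul uc; apply/eqP; rewrite -subr_eq0; apply/eqP.
apply: (proj1 (absv_eq0 w _)); apply/eqP.
rewrite eq_le absv_ge0 andbT; apply/ler_addgt0Pl => e e0; rewrite addr0.
(* [B] bounds l and the late terms of u, and [D] exceeds the Lipschitz constant of the m-th power on
   that ball; the added 1 keeps [D] positive. *)
pose B := w l + 1; pose D := m%:R * B ^+ m.-1 + 1.
have B0 : 0 <= B by rewrite addr_ge0 ?absv_ge0.
have D0 : 0 < D by rewrite ltr_wpDl // mulr_ge0 ?exprn_ge0.
have e2 : 0 < e / 2 by lra.
have [N1 N1P] := ul _ (divr_gt0 e2 D0).
have [N2 N2P] := ul _ ltr01.
have [N3 N3P] := uc _ e2.
pose n := (N1 + N2 + N3)%N.
have h1 := N1P n ltac:(lia); have h2 := N2P n ltac:(lia); have h3 := N3P n ltac:(lia).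
have -> : l ^+ m - c = (l ^+ m - u n ^+ m) + (u n ^+ m - c) by rewrite addrA subrK.
apply: le_trans (absvD _ _ _) _.
suff : w (l ^+ m - u n ^+ m) <= e / 2 by lra.
apply: le_trans (@absv_subX _ _ w B _ _ _ _ _) _; first by rewrite lerDl.
  rewrite -[u n](subrK l); apply: le_trans (absvD _ _ _) _.
  by rewrite addrC lerD2l ltW.
rewrite absvB; apply: le_trans (_ : w (u n - l) * D <= _).
  by rewrite ler_wpM2l ?absv_ge0 // lerDl.
by rewrite -ler_pdivlMr // ltW.
Qed.

(** Taylor expansion with integral remainder: once a Newton step h cancels the constant and linear
    terms, only h^2 r is left. *)
Lemma absv_exprD_order2 (R : realType) (K : fieldType) (w : absolute_value R K) (x h : K) n :
  (forall n, w n%:R <= 1) -> w x <= 1 -> w h <= 1 ->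
  exists2 r, w r <= 1 & (x + h) ^+ n.+1 = x ^+ n.+1 + n.+1%:R * x ^+ n * h + h ^+ 2 * r.
Proof.
move=> wn x1 h1; elim: n => [|n [r r1 IHn]].
  by exists 0; rewrite ?absv0 // !expr1 expr0 mulr0 addr0 !mul1r.
exists (r * (x + h) + n.+1%:R * x ^+ n); last first.
  by rewrite exprSr IHn [x ^+ n.+2]exprSr exprS -[n.+2%:R]natr1; ring.
apply: absv_ultrametric => //.
  rewrite absvM mulr_ile1 ?absv_ge0 //; exact: absv_ultrametric.
by rewrite absvM mulr_ile1 ?absv_ge0 // absvX exprn_ile1 ?absv_ge0.
Qed.

(** If |x + h| < 1, then x = (x + h) - h would have value below 1 by the ultrametric inequality. *)
Lemma absv_unitD (R : realType) (K : fieldType) (w : absolute_value R K) (x h : K) :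
  (forall n, w n%:R <= 1) -> w x = 1 -> w h < 1 -> w (x + h) = 1.
Proof.
move=> wn x1 h1; apply/eqP; rewrite eq_le; apply/andP; split.
  by apply: absv_ultrametric => //; rewrite ?x1 // ltW.
rewrite leNgt; apply/negP => xh1.
pose M := Num.max (w (x + h)) (w h).
have: w (x + h - h) <= M by apply: absv_ultrametric; rewrite ?absvN // le_max lexx ?orbT.
by rewrite addrK x1 leNgt gt_max xh1 h1.
Qed.

(* Newton iteration for X^q - c. *)
Lemma absv_hensel_root (R : realType) (K : fieldType) (w : absolute_value R K)
    (q : nat) (c x0 : K) :
  (forall u : nat -> K, absv_cauchy w u -> exists l : K, absv_converges w u l) ->
  (forall n, w n%:R <= 1) -> w x0 = 1 -> (0 < q)%N ->
  w (x0 ^+ q - c) < w q%:R ^+ 2 ->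
  exists2 x, x ^+ q = c & w (x - x0) < 1.
Proof.
move=> cK wn wx0 q0 hx0.
have ultra := absv_ultrametric wn.
pose dl := w q%:R; pose f x := x ^+ q - c; pose h x := - (f x) / (q%:R * x ^+ q.-1).
have dl0 : 0 < dl by rewrite lt_def absv_ge0 andbT; apply: contraTneq hx0; rewrite -/dl => ->;
  rewrite expr0n /= -leNgt absv_ge0.
have dl1 : dl <= 1 := wn q.
(* [rho] is |f(x0)| / |f'(x0)|^2, the contraction factor; the hypothesis on x0 says exactly that it
   is below 1. *)
pose e0 := w (f x0); pose rho := e0 / dl ^+ 2.
have r0 : 0 <= rho by rewrite divr_ge0 ?absv_ge0 ?exprn_ge0 // ltW.
have r1 : rho < 1 by rewrite ltr_pdivrMr ?exprn_gt0 // mul1r.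
pose u n := iter n (fun x => x + h x) x0.
have den x : w x = 1 -> w (q%:R * x ^+ q.-1) = dl.
  by move=> x1; rewrite absvM absvX x1 expr1n mulr1.
have whE x : w x = 1 -> w (h x) = w (f x) / dl.
  by move=> x1; rewrite absvM absvN absvV den.
(* The iterates remain units close to x0, so the derivative keeps the value [dl]. Geometric decay of
   f is weaker than the true quadratic decay but suffices for convergence. *)
have inv n : [/\ w (u n) = 1, w (u n - x0) <= dl * rho & w (f (u n)) <= e0 * rho ^+ n].
  elim: n => [|n [un1 und fun_le]].
    by rewrite /u /= subrr absv0 expr0 mulr1 mulr_ge0 // ltW.
  have le_e0 : w (f (u n)) <= e0 by apply: le_trans fun_le _;
    rewrite ler_piMr ?absv_ge0 ?exprn_ile1 // ltW.
  have wh := whE _ un1.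
  have hle : w (h (u n)) <= dl * rho.
    by rewrite wh /rho ler_pdivrMr //; apply: le_trans le_e0 _; rewrite le_eqVlt; apply/orP;
      left; apply/eqP; field; lra.
  have hlt1 : w (h (u n)) < 1.
    by apply: le_lt_trans hle _; apply: le_lt_trans r1; rewrite ler_piMl.
  rewrite /u iterS -/(u n); split; first exact: absv_unitD.
    by rewrite addrAC; apply: ultra.
  have [r r_le1] := @absv_exprD_order2 _ _ w (u n) (h (u n)) q.-1 wn ltac:(by rewrite un1) (ltW
    hlt1).
  rewrite prednK // => E.
  have -> : f (u n + h (u n)) = h (u n) ^+ 2 * r.
    have qn0 : q%:R * u n ^+ q.-1 != 0.
      by apply: contraTneq dl0 => qu0; rewrite -(den _ un1) qu0 absv0 ltxx.
    have hE : q%:R * u n ^+ q.-1 * h (u n) = - f (u n) by rewrite mulrC divfK.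
    by rewrite {1}/f E hE /f; ring.
  rewrite absvM absvX; apply: le_trans (_ : w (h (u n)) ^+ 2 <= _).
    by rewrite ler_piMr ?exprn_ge0 ?absv_ge0.
  rewrite wh [rho ^+ _]exprSr [leRHS]mulrA expr_div_n [w _ ^+ 2]expr2 -[leLHS]mulrA.
  have dl2 : 0 < dl ^+ 2 by rewrite exprn_gt0.
  apply: ler_pM => //; first exact: absv_ge0.
    by rewrite divr_ge0 ?absv_ge0 ?ltW.
  by rewrite ler_pM2r // invr_gt0.
have [l ul] : exists l, absv_converges w u l.
  apply: (absv_complete_geometric (C := dl * rho) (rho := rho) cK) => // n.
  have [un1 _ fle] := inv n.
  rewrite /u iterS -/(u n) addrAC subrr add0r whE // ler_pdivrMr //.
  by apply: le_trans fle _; rewrite le_eqVlt; apply/orP; left; apply/eqP; rewrite /rho; field; lra.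
exists l.
  apply: absv_limit_power ul _ => e ep; have [N NP] := geometric_small e0 r0 r1 ep.
  by exists N => n Nn; have [_ _ fle] := inv n; apply: le_lt_trans fle (NP n Nn).
have M0 : 0 < (1 + rho) / 2 by lra.
have [N NP] := ul _ M0; have [_ unx _] := inv N.
apply: le_lt_trans (_ : (1 + rho) / 2 < 1); last by lra.
have -> : l - x0 = (l - u N) + (u N - x0) by rewrite addrA subrK.
apply: ultra; first by rewrite absvB ltW ?NP.
have : dl * rho <= rho by rewrite ler_piMl.
lra.
Qed.

(** * Roots of integers at archimedean places *)

Lemma nat_root_floor (q X : nat) : (0 < q)%N ->
  {A : nat | (A ^ q <= X < A.+1 ^ q)%N}.
Proof.
move=> q0.
have ex0 : exists A, (A ^ q <= X)%N by exists 0; rewrite exp0n.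
have ub A : (A ^ q <= X)%N -> (A <= X)%N.
  by apply: leq_trans; case: A => // A; rewrite -{1}[A.+1]expn1 leq_pexp2l.
exists (ex_maxn ex0 ub); case: ex_maxnP => A -> Amax /=.
by rewrite ltnNge; apply/negP => /Amax; rewrite ltnn.
Qed.

Lemma expnS_sub_le (A q : nat) : (A.+1 ^ q - A ^ q <= q * A.+1 ^ q.-1)%N.
Proof.
rewrite subn_exp subSnn mul1n.
have -> : (q * A.+1 ^ q.-1 = \sum_(i < q) A.+1 ^ q.-1)%N by rewrite sum_nat_const card_ord.
apply: leq_sum => i _.
have -> : (A.+1 ^ q.-1 = A.+1 ^ (q.-1 - i) * A.+1 ^ i)%N.
  by rewrite -expnD subnK //; have := ltn_ord i; lia.
by rewrite leq_mul2l; apply/orP; right; case: (val i) => // j; rewrite leq_exp2r.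
Qed.

(** Binary digits give |m| <= 1 + c + ... + c^(B-1) with c = |2|; the geometric sum is stated with
    its denominator c - 1 cleared. *)
Lemma absv_natr_lt_exp2 (R : realType) (K : fieldType) (w : absolute_value R K) m B :
  1 < w 2%:R -> (m < 2 ^ B)%N -> w m%:R * (w 2%:R - 1) <= w 2%:R ^+ B - 1.
Proof.
move=> w2; elim: B m => [|B IHB] m.
  by rewrite expn0 ltnS leqn0 => /eqP->; rewrite absv0 mul0r subrr.
rewrite expnS => mB; have mE : (m = 2 * m./2 + odd m)%N by lia.
have /IHB {}IHB : (m./2 < 2 ^ B)%N by lia.
have : w m%:R <= w 2%:R * w m./2%:R + 1.
  rewrite {1}mE natrD natrM; apply: le_trans (absvD _ _ _) _; rewrite absvM.
  by rewrite lerD2l; case: odd; rewrite ?absv1 ?absv0.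
rewrite exprS; nra.
Qed.

(* The dyadic approximations of the real q-th root of u from below form a
   Cauchy sequence for w as well, because |2| > 1. *)
Lemma absv_archimedean_root (R : realType) (K : fieldType) (w : absolute_value R K)
    (q u : nat) :
  (forall u : nat -> K, absv_cauchy w u -> exists l : K, absv_converges w u l) ->
  1 < w 2%:R -> (0 < q)%N -> exists x : K, x ^+ q = u%:R.
Proof.
move=> cK w2 q0; pose c := w 2%:R.
have c0 : 0 < c by apply: lt_trans w2.
have cV1 : c^-1 < 1 by rewrite invf_lt1.
have cV0 : 0 <= c^-1 by rewrite invr_ge0 ltW.
have two0 : 2%:R != 0 :> K by apply: contraTneq c0; rewrite /c => ->; rewrite absv0 ltxx.
(* [A n] is the integer part of 2^n times the real q-th root of u. Doubling the scale changes 2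
   [A n] by 0 or 1, so consecutive approximations differ by 0 or 2^-(n+1). *)
pose A n := sval (nat_root_floor (u * 2 ^ (n * q)) q0).
have AP n : (A n ^ q <= u * 2 ^ (n * q) < (A n).+1 ^ q)%N := svalP (nat_root_floor _ q0).
pose x n : K := (A n)%:R / 2%:R ^+ n.
have A_ge n : (2 * A n <= A n.+1)%N.
  rewrite -ltnS -(ltn_exp2r _ _ q0) expnMn; case/andP: (AP n) => h1 _; case/andP: (AP n.+1) => _.
  by apply: leq_ltn_trans; rewrite mulSn expnD mulnCA leq_mul2l h1 orbT.
have A_le n : (A n.+1 <= 2 * A n + 1)%N.
  rewrite -ltnS -(ltn_exp2r _ _ q0); case/andP: (AP n.+1) => h1 _; case/andP: (AP n) => _ h2.
  apply: leq_ltn_trans h1 _; have -> : ((2 * A n + 1).+1 = 2 * (A n).+1)%N by lia.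
  by rewrite expnMn mulSn expnD mulnCA ltn_pmul2l ?expn_gt0.
have [l xl] : exists l, absv_converges w x l.
  apply: (absv_complete_geometric (C := 1) (rho := c^-1) cK) => // n.
  have -> : x n.+1 - x n = (A n.+1 - 2 * A n)%:R / 2%:R ^+ n.+1.
    rewrite natrB // natrM mulrBl /x; congr (_ - _).
    by rewrite exprS invfM mulrACA mulfV // mul1r.
  rewrite absvM absvV absvX -/c exprVn.
  apply: ler_pM; [exact: absv_ge0|by rewrite invr_ge0 exprn_ge0 // ltW| |].
    have : (A n.+1 - 2 * A n <= 1)%N by have := A_le n; lia.
    by case: (_ - _)%N => [|[|]] // _; rewrite ?absv0 ?absv1 ?ler01.
  by rewrite lef_pV2 ?posrE ?exprn_gt0 // exprS ler_peMl ?exprn_ge0 // ltW.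
exists l; apply: absv_limit_power xl _ => e e0.
(* The defect [M] of the q-th power is at most q (A n + 1)^(q-1), and A n + 1 <= (u + 1) 2^n. So [M]
   <= T 2^(n(q-1)) < 2^(n(q-1)+T), and division by 2^(nq) leaves a quantity of order c^-n. *)
pose T := (q * u.+1 ^ q.-1)%N.
have [N NP] := geometric_small (c ^+ T / (c - 1)) cV0 cV1 e0.
exists N => n Nn; apply: le_lt_trans (NP n Nn).
pose M := (u * 2 ^ (n * q) - A n ^ q)%N.
have -> : x n ^+ q - u%:R = - (M%:R / 2%:R ^+ (n * q)).
  case/andP: (AP n) => h _.
  rewrite /x expr_div_n natrB // natrM !natrX mulrBl mulfK ?expf_neq0 // opprB.
  by rewrite -exprM.
rewrite absvN absvM absvV absvX -/c.
have Mlt : (M < 2 ^ (n * q.-1 + T))%N.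
  have h1 : (M <= q * (A n).+1 ^ q.-1)%N.
    apply: leq_trans (expnS_sub_le _ _); rewrite leq_sub2r // ltnW //.
    by case/andP: (AP n).
  have h2 : ((A n).+1 <= u.+1 * 2 ^ n)%N.
    suff : (A n <= u * 2 ^ n)%N by have := expn_gt0 2 n; lia.
    rewrite -(leq_exp2r _ _ q0); case/andP: (AP n) => h _; apply: leq_trans h _.
    rewrite expnMn -expnM leq_mul2r; apply/orP; right.
    by case: (u) => // v; rewrite -{1}[v.+1]expn1 leq_pexp2l.
  apply: leq_ltn_trans (_ : T * 2 ^ (n * q.-1) < _)%N.
    apply: leq_trans h1 _; rewrite /T -mulnA leq_mul2l; apply/orP; right.
    rewrite expnM -expnMn; case: (q.-1) => // j; rewrite leq_exp2r //.
  by rewrite expnD mulnC ltn_pmul2l ?expn_gt0 // ltn_expl.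
have := absv_natr_lt_exp2 w2 Mlt; rewrite -/c => Mle.
have cp : 0 < c - 1 by rewrite subr_gt0.
rewrite ler_pdivrMr ?exprn_gt0 //.
have -> : c ^+ T / (c - 1) * c^-1 ^+ n * c ^+ (n * q) = c ^+ (n * q.-1 + T) / (c - 1).
  rewrite -{1}(prednK q0) mulnS !exprD exprVn.
  by field; rewrite ?lt0r_neq0 ?exprn_gt0.
by rewrite ler_pdivlMr //; lra.
Qed.

(** * Roots of integers at finite places *)

(** If q divides l - 1, Cauchy's theorem provides an element of order q modulo l. Otherwise q has an
    inverse e modulo l - 1, and u^e is a q-th root of u by Fermat. *)
Lemma prime_field_root (l q : nat) : prime l -> prime q ->
  (exists2 g : nat, (g ^ q = 1 %[mod l])%N & (g <> 1 %[mod l])%N) \/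
  (forall u, coprime l u -> exists2 g : nat, coprime l g & (g ^ q = u %[mod l])%N).
Proof.
move=> pl pq; have l1 := prime_gt1 pl.
have [q_dvd|q_ndvd] := boolP (q %| l.-1)%N; [left|right].
  have cardU : #|[set: {unit 'F_l}]| = l.-1.
    by rewrite card_finField_unit card_Fp.
  have [|g _ og] := @Cauchy _ q [set: {unit 'F_l}]%G pq.
    by rewrite cardU.
  have eqF (a b : nat) : (a%:R == b%:R :> 'F_l) = (a == b %[mod l]).
    by rewrite -val_eqE /= !val_Fp_nat.
  pose v : 'F_l := FinRing.uval g; exists (v : nat).
    apply/eqP; rewrite -eqF natrX natr_Zp -/v.
    by rewrite -FinRing.val_unitX -og expg_order.
  apply/eqP; rewrite -eqF natr_Zp -/v.
  apply: contraTneq (prime_gt1 pq) => v1; rewrite -og.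
  have -> : g = 1%g by apply: val_inj.
  by rewrite order1.
move=> u lu; have cq : coprime q l.-1 by rewrite prime_coprime.
have [e f E _] := egcdnP l.-1 (prime_gt0 pq).
rewrite (eqP cq) in E.
exists (u ^ e)%N; first by rewrite coprimeXr.
rewrite -expnM E addn1 expnSr mulnC [(_ * l.-1)%N]mulnC expnM.
have lE : (u ^ l.-1 = 1 %[mod l])%N.
  by rewrite -totient_prime //; apply: Euler_exp_totient; rewrite coprime_sym.
by rewrite -modnMmr -modnXm lE modnXm exp1n modnMmr muln1.
Qed.

(** An integer of value below 1 must be a multiple of l: a Bezout relation between it and l would
    otherwise give |1| < 1. *)
Lemma absv_natr_mod (R : realType) (K : fieldType) (w : absolute_value R K) (l a b : nat) :
  prime l -> (forall n, w n%:R <= 1) -> w l%:R < 1 ->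
  (w (a%:R - b%:R) < 1) = (a == b %[mod l]).
Proof.
move=> pl wn wl; wlog ba : a b / (b <= a)%N => [th|].
  have [ba|/ltnW ab] := leqP b a; first exact: th.
  by rewrite absvB eq_sym th.
rewrite -natrB // eqn_mod_dvd //; move: (a - b)%N => n.
apply/idP/idP => [wn1|/dvdnP[m ->]]; last first.
  by rewrite natrM absvM; apply: le_lt_trans wl; rewrite ler_piMl ?absv_ge0.
apply: contraT; rewrite -prime_coprime // => /eqP cln.
have [n0|n0] := posnP n; first by move: cln pl; rewrite n0 gcdn0 => ->.
have [e f E _] := egcdnP l n0; rewrite gcdnC cln in E.
have := absv1 w.
have -> : 1 = e%:R * n%:R + - (f%:R * l%:R) :> K by rewrite -!natrM E natrD addrAC subrr add0r.
pose M := Num.max (w n%:R) (w l%:R) => E1.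
suff : w (e%:R * n%:R - f%:R * l%:R) <= M by rewrite E1 leNgt gt_max wn1 wl.
apply: absv_ultrametric => //; rewrite ?absvN absvM.
  by apply: le_trans (_ : w n%:R <= _); rewrite ?le_max ?lexx // ler_piMl ?absv_ge0.
by apply: le_trans (_ : w l%:R <= _); rewrite ?le_max ?lexx ?orbT // ler_piMl ?absv_ge0.
Qed.

(* The value of the q-th cyclotomic polynomial at q^q. *)
Definition cyclo_unit (q : nat) : nat := \sum_(i < q) (q ^ q) ^ i.

(** All terms but the first are divisible by q^q, hence by q^3 since q >= 3. *)
Lemma cyclo_unit_mod (q : nat) : (2 < q)%N -> exists t, cyclo_unit q = (q ^ 3 * t).+1.
Proof.
case: q => // q q2; rewrite /cyclo_unit big_ord_recl expn0 add1n.
have : (q.+1 ^ 3 %| \sum_(i < q) (q.+1 ^ q.+1) ^ bump 0 i)%N.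
  apply: dvdn_sum => i _; rewrite /bump /= add1n [X in (_ %| X)%N]expnS dvdn_mulr //.
  by rewrite dvdn_exp2l.
by case/dvdnP => t ->; exists t; rewrite mulnC.
Qed.

Lemma absv_root_or_unity (R : realType) (K : fieldType) (w : absolute_value R K) (q l : nat) :
  (forall u : nat -> K, absv_cauchy w u -> exists l : K, absv_converges w u l) ->
  prime q -> (2 < q)%N -> q%:R != 0 :> K ->
  (forall n, w n%:R <= 1) -> prime l -> w l%:R < 1 ->
  (exists2 z : K, z ^+ q = 1 & z != 1) \/ (exists x : K, x ^+ q = (cyclo_unit q)%:R).
Proof.
move=> cK pq q2 q0 wn pl wl; set u := cyclo_unit q.
have wmod a b := absv_natr_mod a b pl wn wl.
have q_gt0 := prime_gt0 pq.
have wunit a : coprime l a -> w a%:R = 1.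
  move=> la; apply/eqP; rewrite eq_le wn leNgt -[a%:R]subr0 (wmod a 0) mod0n.
  by rewrite -/(l %| a)%N -prime_coprime.
have unity g : (g ^ q = 1 %[mod l])%N -> (g <> 1 %[mod l])%N ->
  w q%:R = 1 -> exists2 z : K, z ^+ q = 1 & z != 1.
  move=> gq g1 wq.
  have lg : coprime l g.
    by rewrite -(coprime_pexpr _ _ q_gt0) -coprime_modr gq coprime_modr coprimen1.
  have [|z zq zg] := @absv_hensel_root _ _ w q 1 g%:R cK wn (wunit _ lg) q_gt0.
    by rewrite wq expr1n -natrX (wmod _ 1%N) gq.
  exists z => //; apply: contra_notN g1 => /eqP z1; apply/eqP.
  by rewrite -(wmod g 1%N) absvB; move: zg; rewrite z1.
have [lq|lq] := eqVneq l q.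
  right; have [t ut] := cyclo_unit_mod q2; rewrite lq in wl.
  (* The factor q^3 of u - 1 gives |u - 1| <= |q|^3 < |q|^2, the strict bound needed to start
     Newton's iteration at 1. *)
  have [|z zq _] := @absv_hensel_root _ _ w q u%:R 1 cK wn (absv1 w) q_gt0.
    rewrite expr1n /u ut absvB -natr1 addrK natrM natrX absvM absvX.
    have wq0 := absv_gt0 w q0.
    apply: le_lt_trans (_ : w q%:R ^+ 3 < _); first by rewrite ler_piMr ?exprn_ge0 ?absv_ge0.
    by rewrite exprS gtr_pMl ?exprn_gt0.
  by exists z.
have wq : w q%:R = 1.
  by apply: wunit; rewrite prime_coprime // dvdn_prime2.
have [lu|lu] := boolP (l %| u)%N.
  (* Since (q^q)^q - 1 = (q^q - 1) u, the integer q^q is a q-th root of unity modulo l. It is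
     nontrivial: q^q = 1 modulo l would give u = q modulo l, so l would divide q. *)
  left; apply: (unity (q ^ q)%N) => //.
    apply/eqP; rewrite eqn_mod_dvd ?expn_gt0 ?q_gt0 // subn1 predn_exp.
    exact: dvdn_mull lu.
  move=> qq1; suff: (l %| q)%N by rewrite dvdn_prime2 // (negPf lq).
  rewrite /dvdn; move: lu; rewrite /dvdn /u /cyclo_unit -modn_summ.
  rewrite (eq_bigr (fun=> 1 %% l)%N) => [|i _]; last by rewrite -modnXm qq1 modnXm exp1n.
  by rewrite modn_summ sum_nat_const card_ord muln1.
case: (prime_field_root pl pq) => [[g gq g1]|/(_ u)]; first by left; apply: unity gq g1 wq.
rewrite prime_coprime // => /(_ lu) [g lg gq]; right.
have [|z zq _] := @absv_hensel_root _ _ w q u%:R g%:R cK wn (wunit _ lg) q_gt0.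
  by rewrite wq expr1n -natrX wmod gq.
by exists z.
Qed.

(* On a number field, v is bounded as soon as it is bounded on the rationals,
   and a bounded absolute value is trivial. *)
Lemma absv_trivial_of_rat (R : realType) (k : fieldExtType rat) (v : absolute_value R k) :
  (forall n, v n.+1%:R = 1) -> forall x, x != 0 -> v x = 1.
Proof.
move=> vn.
have vz (z : int) : v z%:~R <= 1.
  case: z => n; first by case: n => [|n]; rewrite ?absv0 // -[_%:~R]/(n.+1%:R) vn.
  by rewrite NegzE mulrNz absvN -[_%:~R]/(n.+1%:R) vn.
have vA (c : rat) : v c%:A <= 1.
  have -> : c%:A = (numq c)%:~R / (denq c)%:~R :> k.
    by rewrite -{1}(divq_num_den c) -in_algE fmorph_div !rmorph_int.
  have [[|n] -> _] : exists2 n : nat, denq c = n & true by exists `|denq c|%N; rewrite ?absz_denq.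
    (* Denominator 0 never occurs; this branch closes by the convention that the inverse of 0 is
       0. *)
    by rewrite mulr0z invr0 mulr0 absv0.
  by rewrite absvM absvV -[_%:~R in X in _ / X]/(n.+1%:R) vn invr1 mulr1.
pose B := \sum_(i < \dim {:k}) v (vbasis {:k})`_i.
have vB x : v x <= B.
  rewrite (coord_vbasis (memvf x)); apply: le_trans (absv_sum _ _ _ _) _.
  apply: ler_sum => i _; rewrite -[_ *: _]mulr_algl absvM.
  by rewrite ler_piMl ?absv_ge0.
have v1 x : v x <= 1.
  apply: (@affine_powers_le1 _ _ 0 B); first exact: absv_ge0.
  by move=> t; rewrite -absvX mul0r add0r.
move=> x x0; apply/eqP; rewrite eq_le v1 /=.
by have := v1 x^-1; rewrite absvV invf_le1 // absv_gt0.
Qed.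

(** The completion is archimedean if |2| > 1. Otherwise it is ultrametric, and nontriviality of v
    yields a prime of value below 1. *)
Lemma completion_root_or_unity (R : realType) (k : fieldExtType rat)
    (v : absolute_value R k) (K : fieldType) (i : {rmorphism k -> K})
    (w : absolute_value R K) (q : nat) :
  nontrivial_absv v -> is_completion v i w -> prime q -> (2 < q)%N ->
  (exists2 z : K, z ^+ q = 1 & z != 1) \/ (exists x : K, x ^+ q = (cyclo_unit q)%:R).
Proof.
move=> [x x0 vx] [wi _ cK] pq q2.
have wv n : w n%:R = v n%:R by rewrite -wi rmorph_nat.
have natK n : n.+1%:R != 0 :> K.
  by rewrite -(rmorph_nat i) fmorph_eq0 -(rmorph_nat (in_alg k)) fmorph_eq0 pnatr_eq0.
have [w2|/absv_natr_le1 wn] := ltP 1 (w 2%:R).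
  by right; apply: absv_archimedean_root cK w2 (prime_gt0 pq).
have [[l pl wl]|noprime] := pselect (exists2 l, prime l & w l%:R < 1).
  apply: absv_root_or_unity pl wl => //.
  by case: (q) pq => // n _; apply: natK.
(* Without such a prime, strong induction on factorizations gives every positive integer the value
   1, so v would be trivial. *)
exfalso; move/eqP: vx; apply; apply: absv_trivial_of_rat => // n.
rewrite -wv; apply/eqP; rewrite eq_le wn leNgt; apply/negP => wn1; apply: noprime.
have [m] := ubnP n; elim: m n wn1 => // m IHm [|n] wn1 nm; first by rewrite absv1 ltxx in wn1.
have [pn|] := boolP (prime n.+2); first by exists n.+2.
move/primePn => [] // [d /andP[d1 dn] /dvdnP[e E]].
move: wn1; rewrite E natrM absvM.
case: d E d1 dn => // -[|d] // E _ dn; case: e E => // -[|e] E; first by lia.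
have [wd|wd] := ltP (w d.+2%:R) 1; first by move=> _; apply: IHm wd _; lia.
have [we _|we] := ltP (w e.+2%:R) 1; first by apply: IHm we _; nia.
by move/(le_lt_trans (mulr_ege1 we wd)); rewrite ltxx.
Qed.

(** * Lines on diagonal surfaces *)

Lemma poly_zero_of_values (F : fieldType) (P : {poly F}) :
  (forall n, n.+1%:R != 0 :> F) -> (forall t, P.[t] = 0) -> P = 0.
Proof.
move=> F0 P0; apply/eqP; apply: contraT => Pn0.
have natI : injective (fun n : nat => n%:R : F).
  have lt_neq m n : (m < n)%N -> n%:R != m%:R :> F.
    by move=> mn; rewrite -subr_eq0 -natrB 1?ltnW // -(prednK (n := n - m)) ?F0 ?subn_gt0.
  move=> m n /= E; case: (ltngtP m n) => // /lt_neq; by rewrite E eqxx.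
have := @max_poly_roots _ P [seq n%:R | n <- iota 0 (size P)] Pn0.
rewrite size_map size_iota ltnn map_inj_uniq // iota_uniq => -> //.
by apply/allP => x _; apply/rootP.
Qed.

Lemma coef_affine_exp (F : fieldType) (al be : F) d e : (e <= d)%N ->
  ((al%:P + be *: 'X) ^+ d)`_e = al ^+ (d - e) * be ^+ e *+ 'C(d, e).
Proof.
move=> ed; have -> : (al%:P + be *: 'X) ^+ d =
    \poly_(i < d.+1) (al ^+ (d - i) * be ^+ i *+ 'C(d, i)).
  rewrite exprDn poly_def; apply: eq_bigr => i _.
  by rewrite -polyC_exp exprZn mul_polyC scalerA scalerMnl.
by rewrite coef_poly ltnS ed.
Qed.

(** Compare coefficients of t^e. If al and be are both nonzero, e = 1 and e = 2 (both below d) make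
    (ga, de) proportional to (al, be); the two powers then cancel and A = 0. So al or be vanishes,
    and e = 1 forces de or ga, respectively, to vanish too. *)
Lemma diagonal_binary_identity (F : fieldType) (d : nat) (A B C D al be ga de : F) :
  (forall n, n.+1%:R != 0 :> F) -> (2 < d)%N -> A != 0 -> B != 0 -> C != 0 -> D != 0 ->
  (forall t, A + B * t ^+ d + C * (al + be * t) ^+ d + D * (ga + de * t) ^+ d = 0) ->
  (A = - (C * al ^+ d) /\ B = - (D * de ^+ d)) \/
  (A = - (D * ga ^+ d) /\ B = - (C * be ^+ d)).
Proof.
move=> F0 d2 A0 B0 C0 D0 E.
have d0 : (0 < d)%N by apply: ltn_trans d2.
pose P : {poly F} := A%:P + B *: 'X^d + C *: (al%:P + be *: 'X) ^+ d + D *: (ga%:P + de *: 'X) ^+ d.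
have P0 : P = 0.
  by apply: poly_zero_of_values => // t; rewrite /P !hornerE.
have coefP e : (e <= d)%N ->
  A *+ (e == 0) + B *+ (e == d) + (C * (al ^+ (d - e) * be ^+ e) + D * (ga ^+ (d - e) * de ^+ e))
    *+ 'C(d, e) = 0.
  move=> ed; have := congr1 (fun Q : {poly F} => Q`_e) P0.
  rewrite coef0 /P !coefD !coefZ !coef_affine_exp // coefC coefXn => <-.
  rewrite !mulrnAr mulrnDl !addrA.
  by case: eqP => _; case: eqP => _ /=; rewrite ?mulr1n ?mulr0n ?mulr1 ?mulr0.
have eq0 : A + (C * al ^+ d + D * ga ^+ d) = 0.
  have := coefP 0 (leq0n _); rewrite subn0 !expr0 !mulr1 bin0 !mulr1n.
  by rewrite (ltn_eqF d0) mulr0n addr0.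
have eqd : B + (C * be ^+ d + D * de ^+ d) = 0.
  have := coefP d (leqnn _); rewrite subnn !expr0 !mul1r binn !mulr1n eqxx.
  by rewrite (gtn_eqF d0) mulr0n add0r.
have mid e : (0 < e < d)%N -> C * (al ^+ (d - e) * be ^+ e) = - (D * (ga ^+ (d - e) * de ^+ e)).
  case/andP=> e0 ed; have := coefP e (ltnW ed).
  rewrite (gtn_eqF e0) (ltn_eqF ed) !mulr0n !add0r -mulr_natr => /eqP.
  rewrite mulf_eq0 => /orP[|]; first by rewrite addr_eq0 => /eqP.
  have : (0 < 'C(d, e))%N by rewrite bin_gt0 ltnW.
  by case: 'C(d, e) => // n _; rewrite (negPf (F0 n)).
have [al0|al0] := eqVneq al 0.
  have ga0 : ga != 0.
    by apply: contra_neq A0 => ga0; move: eq0; rewrite al0 ga0 !expr0n (gtn_eqF d0) !mulr0 !addr0.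
  have := mid 1%N ltac:(lia); rewrite al0 expr0n subn_eq0 leqNgt (ltn_trans _ d2) //= mul0r mulr0
    => /esym/eqP.
  rewrite oppr_eq0 !mulf_eq0 (negPf D0) expf_eq0 (negPf ga0) andbF /= expr1 => /eqP de0.
  right; split; apply/eqP; rewrite -addr_eq0.
    by rewrite -eq0 al0 expr0n (gtn_eqF d0) mulr0 add0r.
  by rewrite -eqd de0 expr0n (gtn_eqF d0) mulr0 addr0.
have [be0|be0] := eqVneq be 0.
  have := mid 1%N ltac:(lia); rewrite be0 expr1 !mulr0 => /esym/eqP.
  rewrite oppr_eq0 !mulf_eq0 (negPf D0) expf_eq0 subn_gt0 (ltn_trans _ d2) //=.
  have de0 : de != 0.
    by apply: contra_neq B0 => de0; move: eqd; rewrite be0 de0 !expr0n (gtn_eqF d0) !mulr0 !addr0.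
  rewrite (negPf de0) orbF => /eqP ga0.
  left; split; apply/eqP; rewrite -addr_eq0.
    by rewrite -eq0 ga0 expr0n (gtn_eqF d0) mulr0 addr0.
  by rewrite -eqd be0 expr0n (gtn_eqF d0) mulr0 add0r.
exfalso; have [n dE] : exists n, d = n.+3 by exists (d - 3)%N; lia.
(* [X] and [Y] are the factors common to the coefficients for e = 1 and e = 2, so that X (al, be) =
   Y (ga, de). *)
pose X := C * al ^+ n.+1 * be; pose Y := - (D * ga ^+ n.+1 * de).
have XY1 : X * al = Y * ga.
  have := mid 1%N ltac:(lia); rewrite dE !subSS subn0 expr1 /X /Y => E1.
  by transitivity (C * (al ^+ n.+2 * be ^+ 1)); [|rewrite E1]; rewrite !exprS; ring.
have XY2 : X * be = Y * de.
  have := mid 2%N ltac:(lia); rewrite dE !subSS subn0 /X /Y => E2.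
  by transitivity (C * (al ^+ n.+1 * be ^+ 2)); [|rewrite E2]; rewrite !exprS; ring.
have X0 : X != 0 by rewrite !mulf_neq0 ?expf_neq0.
have Y0 : Y != 0 by apply: contra_neq (mulf_neq0 X0 al0) => Y0; rewrite XY1 Y0 mul0r.
have [la gaE deE] : exists2 la, ga = la * al & de = la * be.
  by exists (X / Y); rewrite mulrAC ?XY1 ?XY2 mulrAC mulfV ?mul1r.
have CE : C = - (D * la ^+ d).
  apply: (mulIf (mulf_neq0 (expf_neq0 n.+2 al0) be0)).
  have := mid 1%N ltac:(lia); rewrite dE !subSS subn0 !expr1 gaE deE => ->.
  by rewrite exprMn [la ^+ n.+3]exprS; ring.
have CD0 : C * al ^+ d + D * ga ^+ d = 0 by rewrite CE gaE exprMn; ring.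
by move: eq0; rewrite CD0 addr0; apply/eqP.
Qed.

(** Each pairing of the four coefficients gives two quotients that are d-th powers. Pairing 1 with a
    yields a, and pairing 1 with b yields b. Pairing 1 with ab yields ab and a/b, hence a^2, hence a
    because d is odd. *)
Lemma product_coef_pairing_root (F : fieldType) (d : nat) (a b : F) (c : 'I_4 -> F)
    (i j k l : 'I_4) (x y : F) :
  odd d -> a != 0 -> b != 0 -> (forall j, c j = nth 0 [:: 1; a; b; a * b] j) ->
  uniq [:: i; j; k; l] -> c i = c k * x ^+ d -> c j = c l * y ^+ d ->
  (exists z, z ^+ d = a) \/ (exists z, z ^+ d = b).
Proof.
move=> dodd a0 b0 cE; rewrite !cE.
pose P z := exists x : F, x ^+ d = z.
have PM z t : P z -> P t -> P (z * t).
  by case=> z' <- [t' <-]; exists (z' * t'); rewrite exprMn.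
have PV z : P z -> P z^-1 by case=> z' <-; exists z'^-1; rewrite exprVn.
have sqr z : z != 0 -> P (z ^+ 2) -> P z.
  (* For odd d the exponent d + 1 is even, so z = z^(d+1) / z^d is a d-th power once z^2 is. *)
  move=> z0 [t tE]; exists (t ^+ (d./2.+1) / z).
  rewrite exprMn -exprM mulnC exprM tE -exprM exprVn.
  have -> : (2 * d./2.+1 = d.+1)%N by lia.
  by rewrite exprS mulfK ?expf_neq0.
have rat z t s : z != 0 -> t = z * s ^+ d -> P (t / z).
  by move=> z0 ->; exists s; rewrite mulrC mulKf.
have ab0 : a * b != 0 by rewrite mulf_neq0.
have crossE : P (a * b) -> P (a / b) -> P a.
  by move=> h1 h2; apply: sqr => //; have := PM _ _ h1 h2; congr P; field.
have nth_neq0 (m : 'I_4) : [:: 1; a; b; a * b]`_m != 0.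
  by case: m => -[|[|[|[|m]]]] //= _; apply: oner_neq0.
move=> u Hx Hy.
have {Hx} := rat _ _ _ (nth_neq0 k) Hx; have {Hy} := rat _ _ _ (nth_neq0 l) Hy.
move: u; rewrite -/(P a) -/(P b) /= !inE.
have Va z : P z^-1 -> P z by move/PV; rewrite invrK.
have La1 : P (a * b / b) -> P a by rewrite mulfK.
have La2 : P (b / (a * b)) -> P a by move=> h; apply: Va; move: h; congr P; field; rewrite ?a0 ?b0.
have Lb1 : P (a * b / a) -> P b by rewrite mulrAC mulfV // mul1r.
have Lb2 : P (a / (a * b)) -> P b by move=> h; apply: Va; move: h; congr P; field; rewrite ?a0 ?b0.
case: i => -[|[|[|[|i]]]] //= i_; case: k => -[|[|[|[|k]]]] //= k_;
case: j => -[|[|[|[|j]]]] //= j_; case: l => -[|[|[|[|l]]]] //= l_ _.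
all: rewrite ?divr1 ?div1r => H2 H1.
all: first [by left; do ?apply: Va | by right; do ?apply: Va
  | by left; apply: La1 | by left; apply: La2 | by right; apply: Lb1 | by right;
    apply: Lb2 | idtac].
(* What remains is the pairing of 1 with ab and of a with b. *)
all: left; apply: crossE; do ?[exact H1 | exact H2 | by apply: Va | by apply: Va; rewrite invf_div].
Qed.

(** * The surface and its lines *)

Definition product_coef (k : fieldType) (a b : k) (j : 'I_4) : k :=
  [:: 1; a; b; a * b]`_j.

Lemma product_coef_neq0 (k : fieldType) (a b : k) :
  a != 0 -> b != 0 -> forall j, product_coef a b j != 0.
Proof.
move=> a0 b0 [[|[|[|[|j]]]] jP] //; rewrite /product_coef /=.
  exact: oner_neq0.
exact: mulf_neq0.
Qed.

Definition product_surface (k : fieldType) (d : nat) (a b : k)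
    (a0 : a != 0) (b0 : b != 0) : diagonal_surface k :=
  DiagonalSurface d (product_coef_neq0 a0 b0).

(** A root c of a gives the line x0 = -c x1, x2 = -c x3, and a root c of b gives x0 = -c x2, x1 = -c
    x3. The fourth coefficient ab makes one root serve both pairs of terms. *)
Lemma product_surface_line (k : fieldType) (d : nat) (a b : k)
    (a0 : a != 0) (b0 : b != 0) (K : fieldType) (i : {rmorphism k -> K}) :
  odd d -> (exists c : K, c ^+ d = i a) \/ (exists c : K, c ^+ d = i b) ->
  contains_line_over (product_surface d a0 b0) i.
Proof.
move=> dodd.
have free2 (L : 'M[K]_(2, 4)) (B : 'M[K]_(4, 2)) : L *m B = 1%:M -> \rank L = 2%N.
  by move=> LB; apply/eqP/row_freeP; exists B.
have oppX (E : fieldType) (x : E) : (- x) ^+ d = - x ^+ d.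
  by rewrite exprNn -signr_odd dodd expr1 mulN1r.
case=> [] [c cE].
- exists (\matrix_(s, j) (nth [::] [:: [:: - c; 1; 0; 0]; [:: 0; 0; - c; 1]] s)`_j).
    apply: (free2 _ (\matrix_(j, s) (nth [::] [:: [:: 0; 0]; [:: 1; 0]; [:: 0; 0]; [:: 0; 1]]
      j)`_s)).
    apply/matrixP => [[[|[|s]] sP] [[|[|t]] tP]] //;
      by rewrite !mxE !big_ord_recl big_ord0 !mxE /= ?(mulr0, mul0r, mulr1, mul1r, addr0, add0r).
  move=> E f x _ /submxP[D ->].
  rewrite /on_surface !big_ord_recl big_ord0 !mxE !big_ord_recl !big_ord0 !mxE /product_coef /=.
  rewrite !rmorph0 !rmorph1 !rmorphN !rmorphM -cE !rmorphXn /= !mulr0 !mulr1 !addr0 !add0r !mulrN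
    !oppX !exprMn.
  ring.
- exists (\matrix_(s, j) (nth [::] [:: [:: - c; 0; 1; 0]; [:: 0; - c; 0; 1]] s)`_j).
    apply: (free2 _ (\matrix_(j, s) (nth [::] [:: [:: 0; 0]; [:: 0; 0]; [:: 1; 0]; [:: 0; 1]]
      j)`_s)).
    apply/matrixP => [[[|[|s]] sP] [[|[|t]] tP]] //;
      by rewrite !mxE !big_ord_recl big_ord0 !mxE /= ?(mulr0, mul0r, mulr1, mul1r, addr0, add0r).
  move=> E f x _ /submxP[D ->].
  rewrite /on_surface !big_ord_recl big_ord0 !mxE !big_ord_recl !big_ord0 !mxE /product_coef /=.
  rewrite !rmorph0 !rmorph1 !rmorphN !rmorphM -cE !rmorphXn /= !mulr0 !mulr1 !addr0 !add0r !mulrN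
    !oppX !exprMn.
  ring.
Qed.

Lemma ord4_complement (i j : 'I_4) : i != j ->
  exists k l, uniq [:: i; j; k; l] /\
    forall (V : zmodType) (F : 'I_4 -> V), \sum_m F m = F i + F j + F k + F l.
Proof.
move=> ij.
have /cards2P[k [l [kl S]]] : #|~: [set i; j]| == 2%N.
  by have := cardsC [set i; j]; rewrite cards2 ij card_ord => /eqP.
have inS m : (m \in [set k; l]) = (m != i) && (m != j) by rewrite -S !inE negb_or.
have := inS k; have := inS l; rewrite !inE !eqxx orbT /= => /esym/andP[li lj] /esym/andP[ki kj].
exists k, l; split.
  by rewrite /= !inE !negb_or ij kl ![_ == k]eq_sym ki kj ![_ == l]eq_sym li lj.
move=> V F; rewrite (bigD1 i) //= (bigD1 j) //=; last by rewrite eq_sym.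
rewrite (eq_bigl (mem [set k; l])) => [|m]; last by rewrite inE inS.
by rewrite /= big_setU1 ?inE // big_set1 !addrA.
Qed.

(** Normalizing an invertible 2 by 2 minor of [L] to the identity parametrizes the line with
    coordinates 1 and t at two places and affine forms in t at the other two. This is the situation
    of [diagonal_binary_identity]. *)
Lemma product_surface_line_root (k : fieldType) (d : nat) (a b : k)
    (a0 : a != 0) (b0 : b != 0) :
  (forall n, n.+1%:R != 0 :> k) -> odd d -> (2 < d)%N ->
  contains_line_over (product_surface d a0 b0) (@idfun k) ->
  (exists z, z ^+ d = a) \/ (exists z, z ^+ d = b).
Proof.
move=> k0 dodd d2 [L rkL onS].
have d0 : (0 < d)%N by apply: ltn_trans d2.
have {}onS (v : 'rV[k]_2) : \sum_j product_coef a b j * (v *m L) ord0 j ^+ d = 0.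
  have [v0|v0] := eqVneq (v *m L) 0.
    by rewrite big1 // => j _; rewrite v0 mxE expr0n (gtn_eqF d0) mulr0.
  by have := onS k idfun _ v0; rewrite map_mx_id // => /(_ (submxMl _ _)).
have full : row_full L^T by rewrite /row_full mxrank_tr rkL.
pose f := fullrankfun full; pose U := rowsub f L^T.
have Uu : U^T \in unitmx by rewrite unitmx_tr fullrowsub_unit.
have NE (M : 'M[k]_(2, 4)) t n :
    ((\row_(s < 2) [:: 1; t]`_s) *m M) ord0 n = M 0 n + M 1 n * t.
  rewrite mxE !big_ord_recl big_ord0 !mxE /= mul1r addr0 mulrC.
  by congr (M _ _ + M _ _ * _); apply: val_inj.
pose N := invmx U^T *m L.
have Nf s t : N s (f t) = (s == t)%:R.
  transitivity ((invmx U^T *m U^T) s t); last by rewrite mulVmx // mxE.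
  by rewrite !mxE; apply: eq_bigr => r _; rewrite !mxE.
pose i := f 0; pose j := f 1.
have ij : i != j.
  apply/negP => /eqP ij; have := Nf 0 1; rewrite -/j -ij Nf eqxx /=.
  by move/eqP; rewrite oner_eq0.
have [m [l [uniq4 sum4]]] := ord4_complement ij.
have E t : product_coef a b i + product_coef a b j * t ^+ d
   + product_coef a b m * (N 0 m + N 1 m * t) ^+ d
   + product_coef a b l * (N 0 l + N 1 l * t) ^+ d = 0.
  have := onS ((\row_(s < 2) [:: 1; t]`_s) *m invmx U^T); rewrite -mulmxA -/N sum4.
  by rewrite !NE !Nf /= mul0r addr0 expr1n mulr1 mul1r add0r.
have cn0 := product_coef_neq0 a0 b0.
have oppX (x : k) : - x ^+ d = (- x) ^+ d.
  by rewrite exprNn -signr_odd dodd expr1 mulN1r.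
case: (diagonal_binary_identity k0 d2 (cn0 i) (cn0 j) (cn0 m) (cn0 l) E) => [] [Ei Ej].
  apply: (product_coef_pairing_root (c := product_coef a b) dodd a0 b0 _ uniq4) => //.
    by rewrite Ei -mulrN oppX.
  by rewrite Ej -mulrN oppX.
have uniq4' : uniq [:: i; j; l; m].
  by rewrite (perm_uniq (_ : perm_eq _ [:: i; j; m; l])) // !perm_cons (perm_catC [:: l] [:: m]).
apply: (product_coef_pairing_root (c := product_coef a b) dodd a0 b0 _ uniq4') => //.
  by rewrite Ei -mulrN oppX.
by rewrite Ej -mulrN oppX.
Qed.

(** * The number field *)

Lemma expnS_ge (M n : nat) : (M ^ n.+1 + n.+1 * M ^ n <= M.+1 ^ n.+1)%N.
Proof.
elim: n => [|n IHn]; first by rewrite !expn1 expn0 muln1 addn1.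
rewrite [(M.+1 ^ _)%N]expnS; apply: leq_trans (leq_mul (leqnn _) IHn).
by rewrite [(M ^ n.+2)%N]expnS [(M ^ n.+1)%N]expnS; nia.
Qed.

Lemma cyclo_unit_gt0 q : (0 < q)%N -> (0 < cyclo_unit q)%N.
Proof. by case: q => // q _; rewrite /cyclo_unit big_ord_recl. Qed.

(* With M = q^(q-1), the leading term of cyclo_unit q is M^q, and the other
   terms do not reach (M+1)^q. *)
Lemma cyclo_unit_not_power (q t : nat) : (2 < q)%N -> (t ^ q)%N <> cyclo_unit q.
Proof.
case: q => [|[|[|m]]] // _ E; set q := m.+3 in E.
pose M := (q ^ q.-1)%N; pose r := (\sum_(i < q.-1) (q ^ q) ^ i)%N.
have uE : (cyclo_unit q = M ^ q + r)%N.
  by rewrite /cyclo_unit /q big_ord_recr /= addnC -/q -expnM mulnC expnM.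
have r0 : (0 < r)%N by rewrite /r /q /= big_ord_recl.
have r_lt : (r < q * M ^ q.-1)%N.
  apply: leq_ltn_trans (_ : m.+2 * (q ^ q) ^ m.+1 < _)%N.
    have -> : (m.+2 * (q ^ q) ^ m.+1 = \sum_(i < m.+2) (q ^ q) ^ m.+1)%N.
      by rewrite sum_nat_const card_ord.
    apply: leq_sum => i _; rewrite leq_pexp2l ?expn_gt0 //.
    by rewrite -ltnS.
  apply: leq_trans (_ : q * (q ^ q) ^ m.+1 <= _)%N; first by rewrite ltn_pmul2r ?expn_gt0.
  by rewrite leq_pmul2l // -!expnM leq_pexp2l // /q /=; nia.
have := expnS_ge M q.-1; rewrite -[q.-1.+1]/q => M1.
have : (M < t)%N by rewrite -(@ltn_exp2r _ _ q) // E uE; lia.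
have : (t < M.+1)%N by rewrite -(@ltn_exp2r _ _ q) // E uE; lia.
lia.
Qed.

(** A rational with an integral power is an integer, so u^f is a q-th power t^q; Bezout for q and f
    then makes u one. In the application c is a norm and f the degree of the field. *)
Lemma nat_power_of_rat_power (c : rat) (u q e f : nat) :
  (0 < q)%N -> (0 < e)%N -> (0 < u)%N -> (0 < f)%N -> coprime q f ->
  c ^+ (q * e) = u%:R ^+ (e * f) -> exists t, (t ^ q)%N = u.
Proof.
move=> q0 e0 u0 f0 cqf cE.
pose A := `|numq c|%N; pose B := `|denq c|%N.
have B0 : (0 < B)%N by rewrite absz_gt0 denq_neq0.
have nE : (A ^ (q * e) = u ^ (e * f) * B ^ (q * e))%N.
  apply/eqP; rewrite -(eqr_nat rat) natrM !natrX -cE.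
  have -> : B%:R = (denq c)%:~R :> rat by rewrite -[B%:R]/(B%:~R) absz_denq.
  rewrite -exprMn -numqE; have -> : (A%:R : rat) = `|(numq c)%:~R| by rewrite -intr_norm -abszE.
  rewrite -normrX; apply/eqP/normr_idP.
  by rewrite numqE exprMn cE mulr_ge0 ?exprn_ge0 // ler0z denq_ge0.
have /dvdnP[t tE] : (B %| A)%N.
  by rewrite -(@dvdn_pexp2r _ _ (q * e)) ?muln_gt0 ?q0 // nE dvdn_mull.
have {nE} : (t ^ q = u ^ f)%N.
  apply/eqP; rewrite -(eqn_exp2r _ _ e0) -!expnM [(f * e)%N]mulnC.
  move/eqP: nE; rewrite tE expnMn eqn_pmul2r //.
  by rewrite expn_gt0 B0.
move=> tq; have [a b E _] := egcdnP q f0; rewrite gcdnC (eqP cqf) in E.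
have F : ((t ^ a) ^ q = (u ^ b) ^ q * u)%N.
  by rewrite -expnM mulnC expnM tq -expnM mulnC E expnD expn1 expnM.
have /dvdnP[x xE] : (u ^ b %| t ^ a)%N by rewrite -(@dvdn_pexp2r _ _ q) // F dvdn_mulr.
exists x; apply/eqP; move/eqP: F; rewrite xE expnMn mulnC eqn_pmul2l //.
by rewrite !expn_gt0 u0.
Qed.

(** * Cyclotomic fields and the Kummer generator *)

(** Through [phi] the minimal polynomial of z is that of a primitive n-th root of unity in [algC],
    the n-th cyclotomic polynomial. *)
Lemma dim_cyclotomic (L : fieldExtType rat) (phi : {rmorphism L -> algC}) (n : nat) (z : L) :
  n.-primitive_root z -> \dim <<1; z>>%VS = totient n.
Proof.
move=> zn; rewrite dim_Fadjoin dimv1 muln1.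
have phiA (c : rat) : phi c%:A = ratr c by rewrite alg_num_field fmorph_rat.
have [p [pE _] pP] := minCpolyP (phi z).
have szp : size p = (totient n).+1.
  rewrite -(size_cyclotomic (phi z) n) -minCpoly_cyclotomic ?fmorph_primitive_root //.
  by rewrite pE size_map_poly.
have rootL (g : {poly rat}) : root (map_poly (in_alg L) g) z = (p %| g).
  rewrite -pP -(fmorph_root phi) -map_poly_comp; congr root.
  by apply: eq_map_poly => c /=; rewrite phiA.
have [g gE] : exists g, minPoly 1 z = map_poly (in_alg L) g by apply/polyOver1P/minPolyOver.
apply/eqP; rewrite -eqSS -size_minPoly -szp eqn_leq; apply/andP; split.
  rewrite -(size_map_poly (in_alg L) p); apply: dvdp_leq.
    by rewrite map_poly_eq0 -size_poly_eq0 szp.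
  apply: minPoly_dvdp; first by apply/polyOver1P; exists p.
  by rewrite rootL.
rewrite gE size_map_poly; apply: dvdp_leq.
  by rewrite -(map_poly_eq0 (in_alg L)) -gE monic_neq0 ?monic_minPoly.
by rewrite -rootL -gE root_minPoly.
Qed.

Lemma prime_primitive_root (K : fieldType) (q : nat) (z : K) :
  prime q -> z ^+ q = 1 -> z != 1 -> q.-primitive_root z.
Proof.
move=> pq zq z1; have [m zm] := prim_order_exists (prime_gt0 pq) zq.
have [_ dP] := primeP pq; move/dP => /orP[/eqP m1|/eqP <- //].
by move: z1; rewrite -[z]expr1 -m1 (prim_expr_order zm) eqxx.
Qed.

(* If y = P(z) with P over k, then P^p - y^p and X^q - 1 have a common factor
   over k, which has a root in every field where X^q - 1 splits. *)
Lemma root_transfer (k L K : fieldType) (j : {rmorphism k -> L}) (i : {rmorphism k -> K})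
    (P : {poly k}) (r : k) (zL : L) (zK : K) (p q : nat) :
  (0 < q)%N -> zL ^+ q = 1 -> (map_poly j P).[zL] ^+ p = j r -> q.-primitive_root zK ->
  exists t, t ^+ p = i r.
Proof.
move=> q0 zLq Pz zKq.
pose A := P ^+ p - r%:P; pose B : {poly k} := 'X^q - 1.
have mB (F : fieldType) (f : {rmorphism k -> F}) : map_poly f B = 'X^q - 1.
  by rewrite rmorphB /= map_polyXn rmorph1.
have mA (F : fieldType) (f : {rmorphism k -> F}) x :
    (map_poly f A).[x] = (map_poly f P).[x] ^+ p - f r.
  by rewrite rmorphB rmorphXn /= map_polyC !hornerE.
have Bn0 : B != 0 by rewrite -size_poly_eq0 size_XnsubC.
have g_root : root (map_poly j (gcdp A B)) zL.
  rewrite gcdp_map root_gcd; apply/andP; split; apply/rootP.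
    by rewrite mA Pz subrr.
  by rewrite mB !hornerE zLq subrr.
have g_size : (1 < size (gcdp A B))%N.
  rewrite -(size_map_poly j); apply: root_size_gt1 g_root.
  by rewrite map_poly_eq0 gcdp_eq0 negb_and Bn0 orbT.
have : map_poly i (gcdp A B) %| \prod_(0 <= m < q) ('X - (zK ^+ m)%:P).
  by rewrite factor_Xn_sub_1 // -(mB _ i) dvdp_map dvdp_gcdr.
case/dvdp_prod_XsubC => m gm.
have [x xg] : exists x, root (map_poly i (gcdp A B)) x.
  move: gm; case: (mask _ _) => [|h l] gm.
    by move/eqp_size: gm g_size; rewrite big_nil size_poly1 size_map_poly => ->.
  exists (zK ^+ h); rewrite (eqp_root gm) big_cons rootM.
  by rewrite root_XsubC eqxx.
exists (map_poly i P).[x]; apply/eqP; rewrite -subr_eq0 -mA.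
by move: xg; rewrite gcdp_map root_gcd => /andP[].
Qed.

(** For d = p^al m, the second clause will show that a = r^(d/p) is not a d-th power, the third that
    b = u^(d/q) is not, and the fourth will supply the local roots of a. *)
Lemma kummer_cyclotomic_field (p q al : nat) :
  prime p -> prime q -> (q = 1 %[mod p])%N -> (2 < q)%N -> (0 < al)%N ->
  exists (k : fieldExtType rat) (r : k),
  [/\ r != 0,
      forall m x, coprime p m -> x ^+ (p ^ al * m) <> r ^+ (p ^ al.-1 * m),
      forall e (x : k), (0 < e)%N -> x ^+ (q * e) <> (cyclo_unit q)%:R ^+ e
    & forall (K : fieldType) (i : {rmorphism k -> K}) (z : K),
        z ^+ q = 1 -> z != 1 -> exists t, t ^+ p = i r].
Proof.
move=> pp pq q1 q2 al0; pose N := (p ^ al * q)%N.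
have p_gt0 := prime_gt0 pp; have q_gt0 := prime_gt0 pq.
have pq1 : (p %| q.-1)%N by rewrite -subn1 -eqn_mod_dvd // q1.
have pltq : (p < q)%N.
  have q1_gt0 : (0 < q.-1)%N by rewrite -subn1 subn_gt0 prime_gt1.
  by rewrite -(prednK q_gt0) ltnS dvdn_leq.
have cpq : coprime p q by rewrite prime_coprime // dvdn_prime2 // ltn_eqF.
have cqp1 : coprime q p.-1.
  rewrite prime_coprime // gtnNdvd ?(leq_ltn_trans (leq_pred p)) //.
  by rewrite -subn1 subn_gt0 prime_gt1.
have cqq1 : coprime q q.-1 by rewrite coprime_sym coprimePn.
have cpaq : coprime (p ^ al) q by rewrite coprimeXl.
have pa_gt0 : (0 < p ^ al)%N by rewrite expn_gt0 p_gt0.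
have N0 : (0 < N)%N by rewrite muln_gt0 pa_gt0.
have [L galL [phi _ [w [wN genw] _]]] := group_num_field_exists (Zp_group N).
rewrite /= card_Zp // in wN.
have w0 : w != 0.
  by apply: contra_eq_neq (prim_expr_order wN) => ->; rewrite expr0n (gtn_eqF N0) eq_sym oner_neq0.
pose zq := w ^+ (p ^ al); pose zpa := w ^+ q.
have zqP : q.-primitive_root zq.
  by have := dvdn_prim_root wN (dvdn_mull _ (dvdnn q)); rewrite mulnK.
have zpaP : (p ^ al).-primitive_root zpa.
  by have := dvdn_prim_root wN (dvdn_mulr _ (dvdnn (p ^ al))); rewrite mulKn.
pose zp := zpa ^+ (p ^ al.-1).
have zpP : p.-primitive_root zp.
  have := dvdn_prim_root zpaP (dvdn_exp al0 (dvdnn p)).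
  by rewrite -{1}(prednK al0) expnS mulKn.
have dimL : \dim {:L} = totient N by rewrite -genw (dim_cyclotomic phi wN).
have totN : totient N = (totient (p ^ al) * q.-1)%N.
  by rewrite totient_coprime // (totient_prime pq).
pose F := <<1; zpa>>%AS.
have dimF : \dim F = totient (p ^ al) := dim_cyclotomic phi zpaP.
have galF : galois F {:L} by apply: galoisS galL; rewrite sub1v subvf.
have cardF : #|'Gal({:L} / F)%g| = q.-1.
  by rewrite -(galois_dim galF) dimL totN dimF mulKn // totient_gt0.
(* Cauchy's theorem applies because p divides q - 1, the order of the group. *)
have [s sF os] : {s | s \in 'Gal({:L} / F)%g & #[s]%g = p} by apply: Cauchy; rewrite ?cardF.
pose E := fixedField_aspace <[s]>%G.
have sE a : a \in E -> s a = a.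
  by move/(fixedFieldP (memvf a)); apply; apply: cycle_id.
have Es a : s a = a -> a \in E.
  move=> sa; apply/fixedFieldP => [|x /cycleP[n ->]]; first exact: memvf.
  by elim: n => [|n IHn]; rewrite ?gal_id // expgSr galM ?memvf // IHn.
have FE : (F <= E)%VS.
  by apply/subvP => a aF; apply: Es; apply: fixed_gal (subvf _) sF aF.
have zpaE : zpa \in E by apply: (subvP FE); apply: memv_adjoin.
have zpE : zp \in E by rewrite rpredX.
have gens : generator 'Gal({:L} / E)%g s by rewrite gal_fixedField generator_cycle.
(* [zp] is fixed by s, so its norm is zp^p = 1 and Hilbert 90 applies. Then s y = y / zp, so y^p is
   fixed by s. *)
have [y [_ y0] zpy] : exists2 y, y \in fullv /\ y != 0 & zp = y / s y.
  apply/(Hilbert's_theorem_90 gens (memvf _)).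
  rewrite /galNorm (eq_bigr (fun=> zp)) => [|x xE]; last exact: fixed_gal (subvf _) xE zpE.
  by rewrite prodr_const gal_fixedField -orderE os (prim_expr_order zpP).
have zp0 : zp != 0.
  by apply: contra_eq_neq (prim_expr_order zpP) => ->;
    rewrite expr0n (gtn_eqF p_gt0) eq_sym oner_neq0.
have sy : s y = y / zp by rewrite zpy invf_div mulrCA mulfV ?mulr1.
have yE : y ^+ p \in E.
  by apply: Es; rewrite rmorphXn /= sy expr_div_n (prim_expr_order zpP) divr1.
pose k : fieldExtType rat := subvs_of E.
pose j : {rmorphism k -> L} := vsval.
pose r : k := Subvs yE.
have jr : j r = y ^+ p by [].
exists k, r; split.
- by rewrite -(fmorph_eq0 j) jr expf_neq0.
(* Here t^m is a p^al-th root of unity, hence fixed by s. But s t = t / zp, so zp^m = 1, against the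
   coprimality of p and m. *)
- move=> m x cpm xE; pose t := y / j x.
  have XE : j x ^+ (p ^ al * m) = y ^+ (p ^ al * m).
    by rewrite -rmorphXn xE rmorphXn jr -exprM mulnA -expnS prednK.
  have X0 : j x != 0.
    have m0 : (0 < m)%N.
      by case: (m) cpm => //; rewrite /coprime gcdn0 => /eqP p1; rewrite p1 in pp.
    apply: contra_neq (expf_neq0 (p ^ al * m) y0) => X0.
    by rewrite -XE X0 expr0n muln_eq0 (gtn_eqF pa_gt0) (gtn_eqF m0).
  have tm1 : (t ^+ m) ^+ (p ^ al) = 1.
    by rewrite -exprM mulnC expr_div_n XE mulfV ?expf_neq0.
  have [n tmE] := prim_rootP zpaP tm1.
  have : s (t ^+ m) = t ^+ m by apply: sE; rewrite tmE rpredX.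
  rewrite rmorphXn /= /t fmorph_div /= sy (sE (j x)) ?subvsP // mulrAC expr_div_n.
  have tm0 : (y / j x) ^+ m != 0 by rewrite expf_neq0 // mulf_neq0 ?invr_eq0.
  move=> H; have /eqP : zp ^+ m = 1.
    by apply: (mulfI tm0); rewrite -{1}H divfK ?expf_neq0 // mulr1.
  by rewrite -(prim_order_dvd zpP); apply/negP; rewrite -prime_coprime.
- move=> e x e0 xE.
  have [c cE] : exists c : rat, galNorm 1 {:L} (j x) = c%:A.
    apply/vlineP; have := galNorm_fixedField 1%AS (memvf (j x)).
    by rewrite (galois_fixedField galL).
  have [||||t] := @nat_power_of_rat_power c (cyclo_unit q) q e (totient N) q_gt0 e0.
  - exact: cyclo_unit_gt0.
  - by rewrite totient_gt0.
  (* The degree p^(al-1) (p-1) (q-1) of L is prime to q because p < q. *)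
  - by rewrite totN totient_pfactor // !coprimeMr cqp1 cqq1 coprimeXr // coprime_sym.
  - apply: (fmorph_inj (in_alg L)); rewrite !rmorphXn rmorph_nat.
    transitivity ((c%:A : L) ^+ (q * e)); first by [].
    rewrite -cE -galNormX -rmorphXn xE rmorphXn rmorph_nat galNormX.
    rewrite /galNorm (eq_bigr (fun=> (cyclo_unit q)%:R)) => [|g _]; last by rewrite rmorph_nat.
    by rewrite prodr_const -(galois_dim galL) dimL dimv1 divn1 -exprM mulnC.
  exact: cyclo_unit_not_power.
move=> K i z zKq zK1.
have yEz : y \in <<E; zq>>%VS.
  suff /subvP : (fullv <= <<E; zq>>)%VS by apply; apply: memvf.
  rewrite -genw; apply/FadjoinP; split; first exact: sub1v.
  (* With a q = b p^al + 1, w is the quotient of a power of [zpa], which lies in E, by a power of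
     [zq]; so L = E(zq). *)
  have [a b ab _] := egcdnP (p ^ al) q_gt0; rewrite gcdnC (eqP cpaq) in ab.
  have -> : w = zpa ^+ a / zq ^+ b.
    rewrite -!exprM mulnC ab [(b * _)%N]mulnC exprD expr1 mulrC mulKf //.
    by rewrite expf_neq0.
  apply: rpred_div; apply: rpredX; last exact: memv_adjoin.
  exact: (subvP (subv_adjoin _ _)) zpaE.
have [P PE] : exists P : {poly k}, Fadjoin_poly E zq y = map_poly j P.
  exact/polyOver_subvs/Fadjoin_polyOver.
apply: (root_transfer (j := j) (zL := zq) (P := P) i q_gt0 _ _ (prime_primitive_root pq zKq zK1)).
  exact: prim_expr_order.
by rewrite -PE Fadjoin_poly_eq.
Qed.

(** * Failure of the Hasse principle for the constructed surface *)

Theorem theorem1p3 (R : realType) (d : nat) (hd3 : (3 <= d)%N) (hodd : odd d)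
    (hpq : exists p q : nat,
       [/\ prime p, prime q, (p %| d)%N, (q %| d)%N & (q = 1 %[mod p])%N]) :
  exists (k : fieldExtType rat) (S : diagonal_surface k),
    degree S = d /\ fails_Hasse_principle_for_lines R S.
Proof.
case: hpq => p [q [pp pq pd qd q1]].
have d0 : (0 < d)%N by apply: ltn_trans hd3.
have p_gt0 := prime_gt0 pp; have q_gt0 := prime_gt0 pq.
have q2 : (2 < q)%N by rewrite odd_prime_gt2 // (dvdn_odd qd).
have [m cpm dE] := pfactor_coprime pp d0.
set al := logn p d in dE.
have al0 : (0 < al)%N by rewrite logn_gt0 mem_primes pp d0.
have [k [r [r0 not_pow_r not_pow_u local_r]]] := kummer_cyclotomic_field pp pq q1 q2 al0.
have natk n : n.+1%:R != 0 :> k.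
  by rewrite -(rmorph_nat (in_alg k)) fmorph_eq0 pnatr_eq0.
have u0 : (cyclo_unit q)%:R != 0 :> k.
  by have := cyclo_unit_gt0 q_gt0; case: (cyclo_unit q).
pose a := r ^+ (d %/ p); pose b : k := (cyclo_unit q)%:R ^+ (d %/ q).
have a0 : a != 0 by rewrite expf_neq0.
have b0 : b != 0 by rewrite expf_neq0.
exists k, (product_surface d a0 b0); split=> //; split.
  move=> v v_nontriv K i w wK; apply: product_surface_line => //.
  (* A p-th root of r is a d-th root of a, since d = p (d/p); likewise a q-th root of u is a d-th
     root of b. *)
  have [[z zq z1]|[x xq]] := completion_root_or_unity v_nontriv wK pq q2.
    have [t tp] := local_r K i z zq z1; left; exists t.
    by rewrite /a rmorphXn /= -tp -exprM mulnC divnK.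
  right; exists x.
  by rewrite /b rmorphXn rmorph_nat -xq -exprM mulnC divnK.
case/(product_surface_line_root natk hodd hd3) => -[x].
  have -> : a = r ^+ (p ^ al.-1 * m).
    by rewrite /a {1}dE -(prednK al0) expnS mulnCA mulKn // mulnC.
  by rewrite {1}dE mulnC; apply: not_pow_r.
have dqE : d = (q * (d %/ q))%N by rewrite mulnC divnK.
by rewrite {1}dqE; apply: not_pow_u; rewrite divn_gt0 // dvdn_leq.
Qed.
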